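(* Suppose that $(X,f)$ is a chain mixing dynamical system with a dense set of minimal points. If $(X,f)$ has the $\mathscr{F}_{\underline{d}}$-shadowing property, then $(X,f)$ is weakly mixing.
   Context: $\mathbb{N}=\{1,2,3,\ldots\}$ and $\mathbb{N}_0=\{0,1,2,\ldots\}$. A dynamical system is a pair $(X,f)$ where $(X,d)$ is a compact metric space and $f\colon X\to X$ is a continuous surjection. Transitivity notions: for $A,B\subseteq X$, $N_f(A,B)=\{n\in\mathbb{N}: f^n(A)\cap B\neq\varnothing\}$. $(X,f)$ is transitive if $N_f(U,V)\neq\varnothing$ for all nonempty open $U,V\subseteq X$; it is weakly mixing if $(X\times X,f\times f)$ is transitive. The orbit of $x$ is $\{f^n(x):n\in\mathbb{N}_0\}$; a system is minimal if every point has dense orbit. A point $x$ is a minimal point if the restriction of $f$ to the closure of the orbit of $x$ is a minimal system. Chains: for $\delta>0$, a $\delta$-chain of length $n$ from $x$ to $y$ is a finite sequence $x_0=x,x_1,\ldots,x_n=y$ in $X$ with $d(f(x_i),x_{i+1})<\delta$ for $0\le i<n$. $(X,f)$ is chain mixing if for every $\delta>0$ and every $x,y\in X$ there is $N\in\mathbb{N}$ such that for every $n>N$ there is a $\delta$-chain of length $n$ from $x$ to $y$. Shadowing: for $A\subseteq\mathbb{N}_0$, $\underline{\mathrm{Dens}}(A)=\liminf_{n\to\infty}\frac{\#(A\cap\{0,\ldots,n\})}{n+1}$. A sequence $\{x_i\}_{i=0}^\infty\subseteq X$ is a $\delta$-pseudo-orbit if $d(f(x_i),x_{i+1})<\delta$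 for all $i\in\mathbb{N}_0$. $(X,f)$ has the $\mathscr{F}_{\underline{d}}$-shadowing property if for every $\varepsilon>0$ there is $\delta>0$ such that for every $\delta$-pseudo-orbit $\{x_i\}_{i=0}^\infty$ there is $z\in X$ with $\underline{\mathrm{Dens}}(\{j\in\mathbb{N}_0: d(f^j(z),x_j)<\varepsilon\})>0$. *)

(* Defs.v *)
From mathcomp Require Import all_boot all_order all_algebra.
From mathcomp Require Import all_classical all_reals.
From mathcomp Require Import ereal topology sequences.

Set Implicit Arguments.
Unset Strict Implicit.
Unset Printing Implicit Defensive.

Import Order.TTheory GRing.Theory Num.Theory.

Local Open Scope classical_set_scope.
Local Open Scope ring_scope.

Section Topological.
Context {T : topologicalType}.
Implicit Types (f : T -> T) (A B : set T) (x : T).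

(* The restriction of [f] to the subset [A] is a dynamical system; the system
   [(T, f)] itself is the case [A = setT].  The metric is carried by the type
   of the points. *)
Definition dynamical_system f A : Prop :=
  [/\ compact A, {within A, continuous f} & f @` A = A].

(* [N_f(A, B)]; only positive times are counted. *)
Definition hitting_times f A B : set nat :=
  [set n | (0 < n)%N /\ (iter n f @` A) `&` B !=set0].

Definition topologically_transitive f : Prop :=
  forall U V : set T, open U -> open V -> U !=set0 -> V !=set0 ->
    hitting_times f U V !=set0.

Definition forward_orbit f x : set T := range (fun n => iter n f x).

(* The inclusion [A `<=` closure _] is density in the subspace [A], as the
   orbit of a point of [A] stays in [A]. *)
Definition minimal_system f A : Prop :=
  dynamical_system f A /\ forall y, A y -> A `<=` closure (forward_orbit f y).

Definition minimal_point f x : Prop :=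
  minimal_system f (closure (forward_orbit f x)).

End Topological.

Definition weakly_mixing {T : topologicalType} (f : T -> T) : Prop :=
  topologically_transitive (fun p : T * T => (f p.1, f p.2)).

Definition lower_density {R : realType} (A : set nat) : \bar R :=
  limn_einf (fun n =>
    (#|[pred i : 'I_n.+1 | (i : nat) \in A]|%:R / n.+1%:R)%:E).

Section Metric.
Context {R : realType} {X : metricType R}.
Implicit Types (f : X -> X) (x y : X).

(* A chain is given by its first point [x] and the sequence [s] of the
   following ones, so that its length is [size s]. *)
Definition chain f (delta : R) (n : nat) x y : Prop :=
  exists s : seq X,
    [/\ size s = n, path (fun a b => mdist (f a) b < delta) x s & last x s = y].

Definition chain_mixing f : Prop :=
  forall delta : R, 0 < delta -> forall x y,
    exists N : nat, (0 < N)%N /\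
      forall n : nat, (N < n)%N -> chain f delta n x y.

Definition pseudo_orbit f (delta : R) (u : nat -> X) : Prop :=
  forall i, mdist (f (u i)) (u i.+1) < delta.

Definition lower_density_shadowing f : Prop :=
  forall eps : R, 0 < eps -> exists delta : R, 0 < delta /\
    forall u : nat -> X, pseudo_orbit f delta u ->
      exists z : X, (0 < lower_density (R := R)
                           [set j | mdist (iter j f z) (u j) < eps]%R)%E.

End Metric.

(* Main.v *)
Require Import Defs.
From mathcomp Require Import all_boot all_order all_algebra.
From mathcomp Require Import all_classical all_reals.
From mathcomp Require Import ereal topology sequences.
From mathcomp Require Import zify lra.

(** Weak mixing is reduced to two properties of the sets [N(U, V)] of hitting
times, for nonempty open [U] and [V]: they have bounded gaps, and they contain
arbitrarily long runs of consecutive integers.  A run longer than the gaps of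
[N(U2, V2)] that lies in [N(U1, V1)] yields a common element, that is, a
hitting time of [V1 x V2] from [U1 x U2].

Bounded gaps come from transitivity and a minimal point [x] of
[U `&` f^-q V], which returns there with bounded gaps.  Long runs follow from
the existence, for every nonempty open [U], of two consecutive integers in
[N(U, U)] ([long_run_of_hitting_times]).  So everything rests on transitivity
and on these consecutive return times, and both are produced by shadowing the
same kind of pseudo-orbit ([shadow_two_orbits]).

Given two points [a] and [b], chain mixing and compactness give a length [l]
such that any two points are joined by a chain of length [l].  One can hence
follow [f^j a] for a while, pass to [f^j b] in [l] steps, follow it, come back,
and so on forever, with the clock [j] never reset.  If each stretch is much
longer than the whole past, a set of positive lower density meets all late
stretches, so some [z] is close to [f^j a] for arbitrarily large [j], and to
[f^j b] for arbitrarily large [j].  When [a] and [b] lie on the orbits of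
minimal points [x] in [U] and [y] in [V], closeness at a single time is enough:
the followed orbit enters [U] within a bounded time, during which [z] stays
close to it, so that both are in [U] at the same time ([shadow_visits]).

With [a = x] and [b = y], the point [z] visits [U] and later [V]: this is
transitivity.  With [a = x] and [b = f x], there are [t < t'] such that [f^t z]
and [f^t' z] are in [U], and [f^t x] and [f^(t' + 1) x] are in [U] as well; so
[t' - t] and [t' - t + 1] are both return times of [U]. *)

Set Implicit Arguments.
Unset Strict Implicit.
Unset Printing Implicit Defensive.

Import Order.TTheory GRing.Theory Num.Theory.

Local Open Scope classical_set_scope.
Local Open Scope ring_scope.

(** * Sets of positive lower density *)

Lemma lower_density_gt0_count (R : realType) (A : set nat) :
  (0 < lower_density (R := R) A)%E ->
  exists c : R, 0 < c /\ \forall n \near \oo,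
    c * n.+1%:R <= #|[pred i : 'I_n.+1 | (i : nat) \in A]|%:R.
Proof.
rewrite /lower_density limn_einf_lim (cvg_lim _ (@cvg_einfs_sup _ _))//.
case/ereal_sup_gt => _ [m _ <-] /=.
set v := (fun n => _%:E).
move=> e0; pose e := einfs v m; rewrite -/e in e0.
have ev n : (m <= n)%N -> (e <= v n)%E.
  by move=> mn; apply: ge_ereal_inf; exists (v n) => //; exists n.
have efin : (e < +oo)%E by rewrite (le_lt_trans (ev m (leqnn _))) // ltry.
have eE : e \is a fin_num by rewrite fin_numE -ltey efin gt_eqF// (lt_trans _ e0) ?ltNyr.
exists (fine e); split; first by rewrite fine_gt0// e0.
exists m => //= n mn; rewrite -ler_pdivlMr// -lee_fin fineK//.
exact: ev.
Qed.

Lemma card_ord_pred_le (A : set nat) s n :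
  (forall i, (i < n.+1)%N -> A i -> (i < s)%N) ->
  (#|[pred i : 'I_n.+1 | (i : nat) \in A]| <= s)%N.
Proof.
move=> As; have [sn|/ltnW sn] := leqP s n.+1; last first.
  by rewrite (leq_trans (max_card _))// card_ord.
rewrite -sum1_card -[leqRHS]card_ord -sum1_card (big_ord_widen _ (fun=> 1%N) sn).
rewrite big_mkcond [leqRHS]big_mkcond /=; apply: leq_sum => i _.
by case: ifP => // /set_mem /(As _ (ltn_ord i)) ->.
Qed.

(** If [A] misses [[s k, e k)], then at most [s k] of the first [e k] integers
are in [A]; this contradicts the density when [s k / e k] is small. *)
Lemma positive_density_meets (R : realType) (A : set nat) (s e : nat -> nat) :
    (forall k, k <= s k)%N ->
    (forall m, \forall k \near \oo, m * s k < e k)%N ->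
    (0 < lower_density (R := R) A)%E ->
  \forall k \near \oo, exists2 j, A j & (s k <= j < e k)%N.
Proof.
move=> ks se /lower_density_gt0_count[c [c0 [n0 _ hc]]].
(* any integer above the inverse of the density bound c will do *)
set m := (Num.trunc c^-1).+1.
have cm : 1 < c * m%:R.
  by rewrite mulrC -ltr_pdivrMr// mul1r truncnS_gt.
near=> k; apply: contrapT => none.
have : (m * s k < e k)%N by near: k; exact: se.
have nk : (n0 <= k)%N by near: k; exists n0.
case E : (e k) => [//|n] lt_me.
have msk : (s k <= m * s k)%N by rewrite leq_pmull.
have n0n : (n0 <= n)%N by rewrite (leq_trans nk)// (leq_trans (ks k))//; lia.
have := hc n n0n.
have : (#|[pred i : 'I_n.+1 | (i : nat) \in A]| <= s k)%N.
  apply: card_ord_pred_le => i ltin Ai; rewrite ltnNge; apply/negP => ski.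
  by apply: none; exists i => //; rewrite ski E.
rewrite -(ler_nat R) => h1 h2; have h3 := le_trans h2 h1.
have : m%:R * (s k)%:R < n.+1%:R :> R by rewrite -natrM ltr_nat.
have : 0 <= (s k)%:R :> R by [].
move: cm h3; move: (m%:R) (n.+1%:R) (s k)%:R => M N S; nra.
Unshelve. all: by end_near. Qed.

(** * Hitting times and weak mixing *)

Lemma hitting_timesP (T : topologicalType) (f : T -> T) (U V : set T) n :
  hitting_times f U V n <-> (0 < n)%N /\ exists2 x, U x & V (iter n f x).
Proof.
split=> [[n0 [_ [[x Ux <-] Vx]]]|[n0 [x Ux Vx]]]; split=> //; first by exists x.
by exists (iter n f x); split=> //; exists x.
Qed.

Section TransitiveSystems.
Context {T : topologicalType}.
Implicit Types (f : T -> T) (U V : set T) (x : T).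

Lemma open_iter_preimage f n U : continuous f -> open U -> open (iter n f @^-1` U).
Proof.
move=> fc; elim: n U => [|n IHn] U oU //=.
by apply: (IHn (f @^-1` U)); apply: open_comp.
Qed.

(** Induction on the length of the run.  If [m] returns to [U] and [m + 1]
returns to [V], apply the induction hypothesis to [U `&` f^-m U] and
[V `&` f^-(m+1) V]: a run of hitting times [n, ..., n + L] of these sets is one
for [U] and [V], and so is its translate by [(m + 1) - m = 1].  Both returns
are obtained at once from consecutive return times of a set that transitivity
places inside [U] and, after [q] steps, inside [V]. *)
Lemma long_run_of_hitting_times f :
    continuous f -> topologically_transitive f ->
    (forall U, open U -> U !=set0 ->
      exists n, hitting_times f U U n /\ hitting_times f U U n.+1) ->
  forall L U V, open U -> open V -> U !=set0 -> V !=set0 ->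
    exists n, forall i, (i <= L)%N -> hitting_times f U V (n + i)%N.
Proof.
move=> fc ft pairs; elim=> [|L IHL] U V oU oV U0 V0.
  have [n hn] := ft _ _ oU oV U0 V0.
  by exists n => i; rewrite leqn0 => /eqP ->; rewrite addn0.
have [q /hitting_timesP[_ [x Ux Vx]]] := ft _ _ oU oV U0 V0.
have oW : open (U `&` iter q f @^-1` V) by apply: openI; [|exact: open_iter_preimage].
have [|m [/hitting_timesP[_ [a [Ua _] [Uma _]]]]] := pairs _ oW; first by exists x.
move=> /hitting_timesP[_ [b [_ Vb] [_ Vmb]]].
have [||||n hn] := IHL (U `&` iter m f @^-1` U) (V `&` iter m.+1 f @^-1` V).
- by apply: openI; [|exact: open_iter_preimage].
- by apply: openI; [|exact: open_iter_preimage].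
- by exists a.
- exists (iter q f b); split=> //=.
  by move: Vmb => /=; rewrite -!iterS -!iterD addnC.
exists n => i; rewrite leq_eqVlt => /orP[/eqP ->|iL]; last first.
  have /hitting_timesP[p0 [c [Uc _] [Vc _]]] := hn i iL.
  by apply/hitting_timesP; split=> //; exists c.
have /hitting_timesP[p0 [c [_ Umc] [_ Vc]]] := hn L (leqnn _).
apply/hitting_timesP; split; first by lia.
exists (iter m f c) => //; move: Vc => /=; rewrite -!iterS -!iterD.
by congr (V (iter _ f c)); lia.
Qed.

Lemma long_runs_weakly_mixing f :
    continuous f ->
    (forall L U V, open U -> open V -> U !=set0 -> V !=set0 ->
      exists n, forall i, (i <= L)%N -> hitting_times f U V (n + i)%N) ->
    (forall U V, open U -> open V -> U !=set0 -> V !=set0 ->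
      exists L, forall n, exists2 i, (i <= L)%N & hitting_times f U V (n + i)%N) ->
  weakly_mixing f.
Proof.
move=> fc thick syndetic U V oU oV [[u1 u2] Uu] [[v1 v2] Vv].
have box (O : set (T * T)) p : open O -> O p ->
    exists A B, [/\ open A, open B, A p.1, B p.2 & forall x y, A x -> B y -> O (x, y)].
  rewrite openE => oO /oO [[A B] /= [nA nB] AB].
  exists (interior A), (interior B); split; try exact: open_interior; try by [].
  by move=> x y /interior_subset Ax /interior_subset By; apply: (AB (x, y)).
have [U1 [U2 [oU1 oU2 U1u U2u hU]]] := box _ _ oU Uu.
have [V1 [V2 [oV1 oV2 V1v V2v hV]]] := box _ _ oV Vv.
have [L hL] : exists L, forall n, exists2 i, (i <= L)%N & hitting_times f U2 V2 (n + i)%N.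
  by apply: syndetic => //; [exists u2|exists v2].
have [n hn] : exists n, forall i, (i <= L)%N -> hitting_times f U1 V1 (n + i)%N.
  by apply: thick => //; [exists u1|exists v1].
have [i iL /hitting_timesP[p0 [y U2y V2y]]] := hL n.
have /hitting_timesP[_ [x U1x V1x]] := hn i iL.
exists (n + i)%N; apply/hitting_timesP; split=> //; exists (x, y); first exact: hU.
have -> k : iter k (fun p : T * T => (f p.1, f p.2)) (x, y) = (iter k f x, iter k f y).
  by elim: k => //= k ->.
exact: hV.
Qed.

End TransitiveSystems.

(** * Chains, pseudo-orbits and minimal points *)

Section MetricSystems.
Context {R : realType} {X : metricType R}.
Implicit Types (f : X -> X) (x y : X).

Lemma near_mdist x (e : R) : 0 < e -> \forall y \near x, mdist x y < e.
Proof. by move=> e0; apply/metricType_numDomainType.nbhs_mdistP; exists e. Qed.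

(** Chains can be perturbed at both ends: for [d / 3]-chains from [x] to [y],
moving [x] and [y] slightly costs at most [d / 3] at the first and at the last
step, which may be the same one.  So a length that works at [(x, y)] for
[d / 3] works on a neighbourhood for [d], and the square is compact. *)
Lemma uniform_chain_mixing f (d : R) :
    compact [set: X] -> continuous f -> chain_mixing f -> 0 < d ->
  exists2 l, (0 < l)%N & forall x y, chain f d l x y.
Proof.
move=> cX fc fmix d0.
have cXX : compact [set: X * X] by rewrite -setXTT; exact: compact_setX.
have d3 : 0 < d / 3 by rewrite divr_gt0.
have [] := (iffLR (compact_near_coveringP _) cXX _ \oo
  (fun n p => (0 < n)%N -> chain f d n p.1 p.2)); last first.
  move=> N _ hN; exists N.+1 => // x y.
  exact: (hN N.+1 (leqnSn N) (x, y)).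
case=> x y _; have [N [_ hN]] := fmix _ d3 x y.
have nx : \forall x' \near x, mdist (f x) (f x') < d / 3.
  exact: (fc x _ (near_mdist (f x) d3)).
exists ([set p | mdist (f x) (f p.1) < d / 3 /\ mdist y p.2 < d / 3],
        [set n | (N < n)%N]) => /=.
  split; last by exists N.+1.
  exists ([set x' | mdist (f x) (f x') < d / 3], [set y' | mdist y y' < d / 3]).
    by split=> //; exact: near_mdist.
  by case=> x' y' [].
case=> [[x' y'] n] /= [[xx' yy'] Nn] _.
have [s [szs ps ls]] := hN n Nn.
case/lastP: s szs ps ls => [sz0|s z]; first by move: Nn; rewrite -sz0.
rewrite size_rcons => szs ps.
rewrite last_rcons => zy; subst z; exists (rcons s y'); rewrite size_rcons last_rcons.
split=> //; case: s ps {szs} => [/=|a s].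
  rewrite !andbT => xy.
  have := metric_triangle (f x') (f x) y'; have := metric_triangle (f x) y y'.
  rewrite (metric_sym (f x') (f x)); lra.
rewrite !rcons_cons /= !rcons_path => /and3P[xa pas ly]; apply/and3P; split.
- have := metric_triangle (f x') (f x) a; rewrite (metric_sym (f x') (f x)); lra.
- by apply: sub_path pas => u v /= uv; lra.
- have := metric_triangle (f (last a s)) y y'; lra.
Qed.

(** The time is cut into slots of length [l].  The label [phase q] tells which
orbit the slot [q] starts on; the slot is spent following this orbit if the
next one carries the same label, and on a chain towards the next orbit
otherwise.  Since a chain takes exactly one slot, the orbits stay synchronised
with absolute time. *)
Lemma glue_orbits (I : Type) f (d : R) l (phase : nat -> I) (orb : I -> nat -> X) :
    0 < d -> (0 < l)%N -> (forall x y, chain f d l x y) ->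
    (forall b j, orb b j.+1 = f (orb b j)) ->
  exists u, pseudo_orbit f d u /\
    forall j, phase (j %/ l)%N = phase (j %/ l).+1 -> u j = orb (phase (j %/ l)%N) j.
Proof.
move=> d0 l0 fch orbS.
have piece q : exists c : nat -> X,
      [/\ c 0 = orb (phase q) (q * l)%N, c l = orb (phase q.+1) (q.+1 * l)%N,
          forall r, (r < l)%N -> mdist (f (c r)) (c r.+1) < d &
          phase q = phase q.+1 -> forall r, c r = orb (phase q) (q * l + r)%N].
  have [same|diff] := pselect (phase q = phase q.+1).
    exists (fun r => orb (phase q) (q * l + r)%N); split=> //.
    - by rewrite addn0.
    - by rewrite -same mulSn addnC.
    - by move=> r _; rewrite addnS orbS mdistxx.
  have [s [szs /(pathP (orb (phase q) (q * l)%N)) ps ls]] :=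
    fch (orb (phase q) (q * l)%N) (orb (phase q.+1) (q.+1 * l)%N).
  exists (fun r => nth (orb (phase q) (q * l)%N) (orb (phase q) (q * l)%N :: s) r).
  split=> //; first by rewrite -[RHS]ls -szs nth_last.
  by move=> r rl; apply: ps; rewrite szs.
have [c hc] := choice piece.
exists (fun j => c (j %/ l)%N (j %% l)%N); split; last first.
  by move=> j same; have [_ _ _ ->] := hc (j %/ l)%N => //; rewrite -divn_eq.
move=> j; have [_ cl cS _] := hc (j %/ l)%N.
have jl := ltn_pmod j l0; rewrite modnS divnS//; case: ifP => [dv|_]; last exact: cS.
have [c0 _ _ _] := hc (j %/ l).+1.
rewrite add1n c0 -cl; suff E : (j %% l).+1 = l by have := cS _ jl; rewrite E.
have : (l <= (j %% l).+1)%N.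
  apply: dvdn_leq => //; rewrite -(dvdn_addr _ (dvdn_mull (j %/ l) (dvdnn l))).
  by rewrite addnS -divn_eq.
by move=> lj; apply/eqP; rewrite eqn_leq lj andbT.
Qed.

(** The single bound [N] serves both for the waiting time and for the distance.
A point [w] of the minimal set enters [U] at some time [i], and by continuity of
[f^i] so do all the points near [w]; the bound is made uniform by compactness
of the minimal set.  The point [p] need not lie in the minimal set, which is
what allows shadowing points to be used.  With [p = w] this is the fact that
the return times have bounded gaps. *)
Lemma minimal_point_returns f x (U : set X) :
    continuous f -> minimal_point f x -> open U -> U x ->
  exists N, forall w p, closure (forward_orbit f x) w -> mdist w p < N.+1%:R^-1 ->
    exists i, [/\ (i <= N)%N, U (iter i f w) & U (iter i f p)].
Proof.
move=> fc [[cM _ _] dM] oU Ux.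
have orb0 : closure (forward_orbit f x) x by apply: subset_closure; exists 0%N.
have [] := (iffLR (compact_near_coveringP _) cM _ \oo
  (fun N w => forall p, mdist w p < N.+1%:R^-1 ->
    exists i, [/\ (i <= N)%N, U (iter i f w) & U (iter i f p)])); last first.
  by move=> N _ hN; exists N => w p Mw; exact: (hN N (leqnn N) w Mw p).
move=> w Mw.
have [_ [[i _ <-] Ui]] := dM w Mw x orb0 U (open_nbhs_nbhs (conj oU Ux)).
have : nbhs w (iter i f @^-1` U).
  by apply: open_nbhs_nbhs; split=> //; exact: open_iter_preimage.
move=> /metricType_numDomainType.nbhs_mdistP[e /= e0 he].
have e2 : 0 < e / 2 by rewrite divr_gt0.
have vw : \forall v \near w, mdist w v < e / 2 by exact: near_mdist.
have Ni : \forall N \near \oo, (i <= N)%N /\ N.+1%:R^-1 < e / 2.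
  near=> N; split; near: N; first by exists i.
  exact: (num_normedtype.near_infty_natSinv_lt (PosNum e2)).
exists ([set v | mdist w v < e / 2], [set N | (i <= N)%N /\ N.+1%:R^-1 < e / 2]) => //.
case=> v N /= [wv [iN Ne]] p vp; exists i; split=> //; apply: he => /=.
  by apply: lt_trans wv _; rewrite ltr_pdivrMr// ltr_pMr// ltr1n.
rewrite (le_lt_trans (metric_triangle w v p))// [e]splitr ltrD//.
exact: lt_trans Ne.
Unshelve. all: by end_near. Qed.

End MetricSystems.

(** * Shadowing two orbits alternately *)

(** The labels alternate on the intervals [[T, T ^ 2)] with [T = 2 ^ 2 ^ k], so
that the length of each interval is eventually larger than any given multiple of
its starting point. *)
Definition run_parity (q : nat) : bool := odd (trunc_log 2 (trunc_log 2 q)).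

Lemma run_parityE k q : (2 ^ 2 ^ k <= q < 2 ^ 2 ^ k.+1)%N -> run_parity q = odd k.
Proof.
move=> /andP[kq qk]; rewrite /run_parity (@trunc_log_eq 2 k)//.
have q0 : (0 < q)%N by rewrite (leq_trans _ kq)// expn_gt0.
rewrite trunc_log_max//= -(ltn_exp2l _ _ (ltnSn 1)).
exact: leq_ltn_trans (trunc_logP _ q0) qk.
Qed.

Lemma ltn_exp2exp2 k : (k < 2 ^ 2 ^ k)%N.
Proof. by apply: (@ltn_trans (2 ^ k)); apply: ltn_expl. Qed.

(** The last slot of a run is spent on a transition, hence the predecessor. *)
Lemma run_starts_negligible l m : (0 < l)%N ->
  \forall k \near \oo, (m * (l * 2 ^ 2 ^ k) < l * (2 ^ 2 ^ k.+1).-1)%N.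
Proof.
move=> l0; exists m.+1 => // k /= mk.
have kT := ltn_exp2exp2 k.
have -> : (2 ^ 2 ^ k.+1 = 2 ^ 2 ^ k * 2 ^ 2 ^ k)%N by rewrite expnS mul2n -addnn expnD.
rewrite mulnCA ltn_pmul2l//; move: kT; set T := (2 ^ 2 ^ k)%N; nia.
Qed.

Section Shadowing.
Context {R : realType} {X : metricType R}.
Implicit Types (f : X -> X) (x y : X).

Lemma shadow_two_orbits f x y (e : R) :
    compact [set: X] -> continuous f -> chain_mixing f ->
    lower_density_shadowing f -> 0 < e ->
  exists z, forall (c : bool) n, exists2 j, (n <= j)%N &
    mdist (iter j f z) (iter j f (if c then x else y)) < e.
Proof.
move=> cX fc fmix fsh e0; have [d [d0 hd]] := fsh _ e0.
have [l l0 fch] := uniform_chain_mixing cX fc fmix d0.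
have [u [pu uE]] := glue_orbits run_parity d0 l0 fch
  (fun (c : bool) j => erefl (iter j.+1 f (if c then x else y))).
have [z dz] := hd u pu; exists z => c n.
have [||k0 _ hk0] := @positive_density_meets R _ (fun k => l * 2 ^ 2 ^ k)%N
  (fun k => l * (2 ^ 2 ^ k.+1).-1)%N _ _ dz.
- move=> k; have := ltn_exp2exp2 k; set T := (2 ^ 2 ^ k)%N; nia.
- by move=> m; exact: run_starts_negligible.
pose k := ((maxn k0 n).*2 + c)%N.
have [|j /= zj /andP[kj jk]] := hk0 k; first by rewrite /=; lia.
have kT := ltn_exp2exp2 k.
exists j; first by apply: leq_trans kj; move: kT; set T := (2 ^ 2 ^ k)%N; rewrite /k; nia.
have kq : (2 ^ 2 ^ k <= j %/ l)%N by rewrite leq_divRL// mulnC.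
have qk : ((j %/ l).+1 < 2 ^ 2 ^ k.+1)%N.
  suff : (j %/ l < (2 ^ 2 ^ k.+1).-1)%N by lia.
  by rewrite ltn_divLR// mulnC.
have ck : odd k = c by rewrite oddD odd_double; case: (c).
have pq : run_parity (j %/ l) = c by rewrite (@run_parityE k)// kq ltnW.
have pq1 : run_parity (j %/ l).+1 = c by rewrite (@run_parityE k)// (leq_trans kq) ?qk.
by move: zj; rewrite uE pq// pq1.
Qed.

(** Only the visit to [V] has to come after the visit to [U]; it does because
[z] is close to the orbit of [b] at arbitrarily late times. *)
Lemma shadow_visits f x y a b (U V : set X) :
    compact [set: X] -> continuous f -> chain_mixing f ->
    lower_density_shadowing f ->
    minimal_point f x -> forward_orbit f x a -> open U -> U x ->
    minimal_point f y -> forward_orbit f y b -> open V -> V y ->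
  exists z t t', [/\ (t < t')%N, U (iter t f a) /\ U (iter t f z) &
                     V (iter t' f b) /\ V (iter t' f z)].
Proof.
move=> cX fc fmix fsh mx [n _ <-] oU Ux my [m _ <-] oV Vy.
have [N hN] := minimal_point_returns fc mx oU Ux.
have [M hM] := minimal_point_returns fc my oV Vy.
have e0 : 0 < Order.min N.+1%:R^-1 M.+1%:R^-1 :> R by rewrite lt_min !invr_gt0 !ltr0n.
have [z hz] := shadow_two_orbits (iter n f x) (iter m f y) cX fc fmix fsh e0.
have orb k i w : closure (forward_orbit f w) (iter k f (iter i f w)).
  by apply: subset_closure; exists (k + i)%N => //; rewrite iterD.
have [j _] := hz true 0%N; rewrite metric_sym lt_min => /andP[zj _].
have [i [_ Ui Uzi]] := hN _ _ (orb _ _ _) zj.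
have [j' jj'] := hz false (i + j).+1; rewrite metric_sym lt_min => /andP[_ zj'].
have [i' [_ Vi Vzi]] := hM _ _ (orb _ _ _) zj'.
exists z, (i + j)%N, (i' + j')%N; split; first by lia.
- by rewrite !(iterD i j).
- by rewrite !(iterD i' j').
Qed.

(** * Hitting times under shadowing *)

Lemma shadowing_transitive f :
    compact [set: X] -> continuous f -> chain_mixing f ->
    dense [set x | minimal_point f x] -> lower_density_shadowing f ->
  topologically_transitive f.
Proof.
move=> cX fc fmix fdense fsh U V oU oV U0 V0.
have self x : forward_orbit f x x by exists 0%N.
have [x [Ux mx]] := fdense U U0 oU.
have [y [Vy my]] := fdense V V0 oV.
have [z [t [t' [tt' [_ Uz] [_ Vz]]]]] :=
  shadow_visits cX fc fmix fsh mx (self x) oU Ux my (self y) oV Vy.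
exists (t' - t)%N; apply/hitting_timesP; split; first by rewrite subn_gt0.
by exists (iter t f z) => //; rewrite -iterD subnK// ltnW.
Qed.

(** The orbits of [x] and of [f x] are the same up to a delay of one.  A point
[z] that visits [U] along the first one and later along the second one returns
one step sooner than [x] itself. *)
Lemma consecutive_return_times f (U : set X) :
    compact [set: X] -> continuous f -> chain_mixing f ->
    dense [set x | minimal_point f x] -> lower_density_shadowing f ->
    open U -> U !=set0 ->
  exists n, hitting_times f U U n /\ hitting_times f U U n.+1.
Proof.
move=> cX fc fmix fdense fsh oU U0.
have [x [Ux mx]] := fdense U U0 oU.
have xx : forward_orbit f x x by exists 0%N.
have fx : forward_orbit f x (f x) by exists 1%N.
have [z [t [t' [tt' [Ut Uz] [Ut' Uz']]]]] :=
  shadow_visits cX fc fmix fsh mx xx oU Ux mx fx oU Ux.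
exists (t' - t)%N; split; apply/hitting_timesP; split=> //.
- by rewrite subn_gt0.
- by exists (iter t f z) => //; rewrite -iterD subnK// ltnW.
- exists (iter t f x) => //; rewrite -iterD addSn subnK ?(ltnW tt')//.
  by rewrite iterSr.
Qed.

Lemma hitting_times_bounded_gaps f (U V : set X) :
    continuous f -> dense [set x | minimal_point f x] ->
    topologically_transitive f -> open U -> open V -> U !=set0 -> V !=set0 ->
  exists L, forall n, exists2 i, (i <= L)%N & hitting_times f U V (n + i)%N.
Proof.
move=> fc fdense ft oU oV U0 V0.
have [q /hitting_timesP[q0 [a Ua Va]]] := ft U V oU oV U0 V0.
have oW : open (U `&` iter q f @^-1` V) by apply: openI; [|exact: open_iter_preimage].
have [|x [Wx mx]] := fdense _ _ oW; first by exists a.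
have [N hN] := minimal_point_returns fc mx oW Wx.
exists (N + q)%N => n.
have [||i [iN [_ Vi] _]] := hN (iter n f x) (iter n f x).
- by apply: subset_closure; exists n.
- by rewrite mdistxx invr_gt0 ltr0n.
exists (i + q)%N; first by rewrite leq_add2r.
apply/hitting_timesP; split; first by rewrite addnA ltn_addl.
exists x; first by case: Wx.
by move: Vi => /=; rewrite -!iterD; congr (V (iter _ f x)); lia.
Qed.

End Shadowing.

Theorem corollary3p1 (R : realType) (X : metricType R) (f : X -> X)
  (f_system : dynamical_system f [set: X])
  (f_chain_mixing : chain_mixing f)
  (f_minimal_dense : dense [set x | minimal_point f x])
  (f_shadowing : lower_density_shadowing f) :
  weakly_mixing f.
Proof.
have [cX fcT _] := f_system.
have fc : continuous f := iffRL (continuous_subspace_setT f) fcT.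
have ft := shadowing_transitive cX fc f_chain_mixing f_minimal_dense f_shadowing.
apply: long_runs_weakly_mixing => // [|U V]; last first.
  exact: hitting_times_bounded_gaps.
by apply: long_run_of_hitting_times => // U; exact: consecutive_return_times.
Qed.
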